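(* If $p$ is a $0$-maximal polynomial of degree $n\ge 2$, then $d(p)=|p|_0$.
   Context: For a polynomial $p$, $Z(p)$ denotes its set of complex zeros. $S(n,0)$ is the set of all monic complex polynomials of degree $n$ having all their zeros in the closed unit disk and having at least one zero at $0$. For $p\in S(n,0)$ put $|p|_0=\min_{w\in Z(p')}|w|$. A polynomial $p\in S(n,0)$ is called $0$-maximal if $|p|_0\ge |q|_0$ for every $q\in S(n,0)$. For a monic polynomial $p$ of degree $n\ge 2$ with all zeros in the closed unit disk, $d(p)=\max_{z\in Z(p)}\min_{w\in Z(p')}|z-w|$. *)

(* Defs.v *)
From HB Require Import structures.
From mathcomp Require Import all_boot all_order all_algebra.
From mathcomp Require Import complex.
From mathcomp Require Import all_classical all_reals.

Set Implicit Arguments.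
Unset Strict Implicit.
Unset Printing Implicit Defensive.

Import Order.TTheory GRing.Theory Num.Theory.
Local Open Scope classical_set_scope.
Local Open Scope complex_scope.
Local Open Scope ring_scope.

Import ComplexField.Normc.

Definition is_setmin {R : realType} (A : set R) (m : R) := A m /\ lbound A m.
Definition is_setmax {R : realType} (A : set R) (m : R) := A m /\ ubound A m.

(* Junk value 0 if there is no least (resp. greatest) element; this does not
   occur for zero sets of polynomials of positive degree, see [setminP],
   [setmaxP], [finite_zeros] and [zeros_neq0]. *)
Definition setmin {R : realType} (A : set R) : R := xget 0 (is_setmin A).
Definition setmax {R : realType} (A : set R) : R := xget 0 (is_setmax A).

Definition zeros {R : realType} (p : {poly R[i]}) : set R[i] :=
  [set z | root p z].

Definition crit_dist {R : realType} (p : {poly R[i]}) (z : R[i]) : R :=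
  setmin [set normc (z - w) | w in zeros p^`()].

(* |p|_0 *)
Definition crit_radius {R : realType} (p : {poly R[i]}) : R :=
  setmin [set normc w | w in zeros p^`()].

(* d(p) *)
Definition sendov_dist {R : realType} (p : {poly R[i]}) : R :=
  setmax [set crit_dist p z | z in zeros p].

(* S(n,0) *)
Definition polyS0 {R : realType} (n : nat) : set {poly R[i]} :=
  [set p | [/\ p \is monic, size p = n.+1,
               forall z, root p z -> normc z <= 1 & root p 0]].

Definition zero_maximal {R : realType} (n : nat) (p : {poly R[i]}) : Prop :=
  polyS0 n p /\ forall q, polyS0 n q -> crit_radius q <= crit_radius p.

Lemma finite_ex_setmin {R : realType} (A : set R) :
  finite_set A -> A !=set0 -> exists m, is_setmin A m.
Proof.
move=> /finite_seqP[s ->{A}]; elim: s => [|a s IHs] [x /= xs]; first by [].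
have [s0|/negP/negP] := eqVneq s [::].
  exists a; split; first exact: mem_head.
  by move=> y /=; rewrite s0 inE => /eqP ->.
case: s IHs {xs} => [//|b s] IHs _.
have [|m [ms lem]] := IHs; first by exists b; exact: mem_head.
have [am|/ltW ma] := leP a m.
  exists a; split; first exact: mem_head.
  move=> y; rewrite /= inE => /predU1P[->//|ys].
  by apply: (le_trans am); apply: lem.
exists m; split; first by rewrite /= inE; apply/orP; right.
by move=> y; rewrite /= inE => /predU1P[->//|ys]; apply: lem.
Qed.

Lemma setminP {R : realType} (A : set R) :
  finite_set A -> A !=set0 -> is_setmin A (setmin A).
Proof.
by move=> fA A0; have [m mA] := finite_ex_setmin fA A0; apply: (xgetPex 0); exists m.
Qed.

Lemma setmaxP {R : realType} (A : set R) :
  finite_set A -> A !=set0 -> is_setmax A (setmax A).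
Proof.
move=> fA [a Aa].
have [||m [[b Ab bm] lem]] := @finite_ex_setmin R [set - x | x in A].
- exact: finite_image.
- by exists (- a), a.
apply: (xgetPex 0); exists b; split=> // y Ay.
by rewrite -lerN2 bm; apply: lem; exists y.
Qed.

Lemma finite_zeros {R : realType} (p : {poly R[i]}) :
  p != 0 -> finite_set (zeros p).
Proof.
move=> p0; have [r pr] := closed_field_poly_normal p.
apply: (sub_finite_set _ (finite_seq r)) => z /=.
by rewrite /zeros /= pr rootZ ?lead_coef_eq0// root_prod_XsubC.
Qed.

Lemma zeros_neq0 {R : realType} (p : {poly R[i]}) :
  (1 < size p)%N -> zeros p !=set0.
Proof. by move=> p1; apply/closed_rootP; rewrite gtn_eqF. Qed.

(* Main.v *)
(** Comparing a 0-maximal polynomial [p] with [z ^ n - z] shows that its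
    critical points satisfy [|w| >= r], where [n * r ^ (n - 1) = 1].  Since
    [p'(0)] is, up to sign, the product of the nonzero zeros as well as [n]
    times the product of the critical points, all critical points have modulus
    exactly [r] and all nonzero zeros have modulus [1].  For a zero [a] with
    [|a| = 1], comparing [p''(a)] and [p'(a)] gives
    [\sum_w 1 / (a - w) = 2 * \sum_(z != a) 1 / (a - z)], whence
    [\sum_w Re (a / (a - w)) = n].  If every critical point were at distance
    more than [r] from [a], each of these [n - 1] real parts would be less than
    [1 / (2 * r ^ 2)], contradicting [n - 1 <= 2 * n * r ^ 2]. *)
Require Import Defs.
From mathcomp Require Import all_boot all_order all_algebra.
From mathcomp Require Import complex.
From mathcomp Require Import all_classical all_reals.
From mathcomp Require Import zify ring.

Import Order.TTheory GRing.Theory Num.Theory.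
Import ComplexField.Normc.

Local Open Scope complex_scope.
Local Open Scope ring_scope.

(** * The numerical inequality between the degree and [r] *)

Lemma expn_bernoulli (a k : nat) : (a ^ k * (a + k) <= a * a.+1 ^ k)%N.
Proof.
elim: k => [|k IHk]; first by rewrite !expn0; lia.
rewrite !expnS; nia.
Qed.

(** This is the [m]-th power of [m <= 2 * (m + 1) * r ^ 2], with [r ^ m] replaced by [1 / (m + 1)].
    For [m >= 3] it is the product of [le_2mm], which is Bernoulli's inequality with [a = k = m],
    and [sqr_le]; the latter fails at [m = 2], so small cases are computed. *)
Lemma expn_self_le (m : nat) :
  (0 < m)%N -> (m ^ m * m.+1 ^ 2 <= 2 ^ m * m.+1 ^ m)%N.
Proof.
move=> m0; have [m2|m3] := leqP m 2; first by case: m m0 m2 => [|[|[|]]].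
have le_2mm : (2 * m ^ m <= m.+1 ^ m)%N by have := expn_bernoulli m m; nia.
have sqr_le : (m.+1 ^ 2 <= 2 * 2 ^ m)%N.
  elim: m m3 {m0 le_2mm} => [//|m IHm]; rewrite ltnS leq_eqVlt.
  move=> /predU1P[<- //|m3]; have := IHm m3.
  by rewrite -!mulnn [(2 ^ m.+1)%N]expnS; nia.
nia.
Qed.

Lemma le_sqr_of_exp_eq (R : numDomainType) (m : nat) (r : R) :
  (0 < m)%N -> 0 <= r -> m.+1%:R * r ^+ m = 1 ->
  m%:R <= 2 * m.+1%:R * r ^+ 2.
Proof.
move=> m0 r0 rE.
rewrite -(@ler_pXn2r _ m) ?nnegrE ?mulr_ge0 ?exprn_ge0//.
rewrite -(@ler_pM2r _ (m.+1%:R ^+ 2)) ?exprn_gt0//.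
have -> : (2 * m.+1%:R * r ^+ 2) ^+ m * m.+1%:R ^+ 2
    = (2 ^+ m * m.+1%:R ^+ m) * (m.+1%:R * r ^+ m) ^+ 2.
  by rewrite !exprMn; ring.
by rewrite rE expr1n mulr1 -!natrX -!natrM ler_nat expn_self_le.
Qed.

(** * Products that attain their extremal value *)

Lemma prod_ge_exp (R : numDomainType) (a : R) (s : seq R) :
  0 <= a -> {in s, forall x, a <= x} -> a ^+ size s <= \prod_(x <- s) x.
Proof.
move=> a0 sa; rewrite -iter_mulr_1 -[size s](count_predT s) -big_const_seq.
rewrite big_seq [leRHS]big_seq.
by apply: ler_prod => x /sa ->; rewrite a0.
Qed.

(** Once one factor is removed, the others still multiply to at least the corresponding power of
    [a], which leaves no room for that factor to exceed [a]. A [numDomainType] suffices, so this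
    applies to moduli taken as elements of a closed field. *)
Lemma prod_le_exp_eq (R : numDomainType) (a : R) (s : seq R) :
  0 < a -> {in s, forall x, a <= x} -> \prod_(x <- s) x <= a ^+ size s ->
  {in s, forall x, x = a}.
Proof.
move=> a0 sa + x xs; have sE := perm_to_rem xs.
rewrite (perm_big _ sE) (perm_size sE) big_cons exprS /= => le_prod.
have ge_rem : a ^+ size (rem x s) <= \prod_(y <- rem x s) y.
  by apply: prod_ge_exp => [|y /mem_rem /sa]; first exact: ltW.
apply: le_anti; rewrite sa// andbT.
rewrite -(@ler_pM2r _ (a ^+ size (rem x s))) ?exprn_gt0//.
apply: le_trans le_prod; rewrite ler_wpM2l//.
by apply: le_trans (sa _ xs); exact: ltW.
Qed.

Lemma prod_ge1_eq (R : numDomainType) (s : seq R) :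
  {in s, forall x, 0 <= x <= 1} -> 1 <= \prod_(x <- s) x ->
  {in s, forall x, x = 1}.
Proof.
move=> s01 + x xs; rewrite (perm_big _ (perm_to_rem xs)) big_cons => ge1.
have /andP[x0 x1] := s01 _ xs.
apply: le_anti; rewrite x1; apply: (le_trans ge1).
rewrite ler_piMr// big_seq prodr_ile1// => y /mem_rem; exact: s01.
Qed.

(** * Logarithmic derivatives at a simple zero *)

Lemma horner_deriv_prod_XsubC (F : fieldType) (s : seq F) (a : F) :
  a \notin s ->
  (\prod_(z <- s) ('X - z%:P))^`().[a] =
  (\prod_(z <- s) ('X - z%:P)).[a] * \sum_(z <- s) (a - z)^-1.
Proof.
elim: s => [|b s IHs]; first by rewrite !big_nil derivC !hornerE.
rewrite inE negb_or => /andP[ab /IHs {}IHs].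
rewrite !big_cons derivM derivXsubC !hornerE IHs.
by field; rewrite subr_eq0.
Qed.

(** Writing the polynomial as [('X - a) * S], its first two derivatives at [a] are [S(a)] and
    [2 * S'(a)]; as the first derivative is [c * W], the logarithmic derivative of [W] at [a] is
    twice that of [S]. *)
Lemma sum_inv_crit (F : fieldType) (c a : F) (zs ws : seq F) :
  (\prod_(z <- a :: zs) ('X - z%:P))^`() = c *: \prod_(w <- ws) ('X - w%:P) ->
  a \notin zs -> a \notin ws ->
  \sum_(w <- ws) (a - w)^-1 = 2 * \sum_(z <- zs) (a - z)^-1.
Proof.
rewrite big_cons; set S := \prod_(z <- zs) _; set W := \prod_(w <- ws) _.
move=> dE azs aws.
have S0 : S.[a] != 0 by rewrite -[_ == 0]/(root S a) root_prod_XsubC.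
have d1 : S.[a] = c * W.[a].
  by rewrite -hornerZ -dE derivM derivXsubC !hornerE subrr mul0r addr0.
have d2 : 2 * S^`().[a] = c * W^`().[a].
  rewrite -[RHS]hornerZ -derivZ -dE derivM derivXsubC mul1r derivD derivM derivXsubC mul1r.
  by rewrite !hornerD hornerM hornerXsubC subrr mul0r addr0 mulr_natl.
apply: (mulfI S0); rewrite {1}d1 -mulrA -horner_deriv_prod_XsubC// -d2.
by rewrite horner_deriv_prod_XsubC//; ring.
Qed.

(** * Critical points and their distance to the zeros *)

Lemma deriv_monic_factorization (C : numClosedFieldType) (m : nat) (p : {poly C}) :
  p \is monic -> size p = m.+2 ->
  {ws : seq C | size ws = m &
    p^`() = m.+1%:R *: \prod_(w <- ws) ('X - w%:P)}.
Proof.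
move=> pm ps.
have dm : p^`()`_m = m.+1%:R.
  by move/monicP: pm; rewrite coef_deriv lead_coefE ps => ->.
have ds : size p^`() = m.+1.
  apply/eqP; rewrite eqn_leq -ltnS -ps lt_size_deriv ?monic_neq0//=.
  by rewrite ltnNge; apply/negP => /leq_sizeP/(_ _ (leqnn _))/eqP; rewrite dm pnatr_eq0.
have [ws dE] := closed_field_poly_normal p^`().
rewrite lead_coefE ds dm in dE; exists ws => //.
by move: ds; rewrite dE size_scale ?pnatr_eq0// size_prod_XsubC => -[].
Qed.

(** Expanding [|a - w| ^ 2] with [a * a^* = 1] gives this. The value is [1 / 2] when [|w| = 1], and
    for fixed [|w| < 1] it decreases as [|a - w|] grows. *)
Lemma Re_div_sub (C : numClosedFieldType) (a w : C) :
  `|a| = 1 -> a != w ->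
  'Re (a / (a - w)) = 2^-1 * (1 + (1 - `|w| ^+ 2) / `|a - w| ^+ 2).
Proof.
move=> a1 aw; have aw0 : a - w != 0 by rewrite subr_eq0.
have awc0 : a^* - w^* != 0 by rewrite -rmorphB fmorph_eq0.
have aa : a * a^* = 1 by rewrite -normCK a1 expr1n.
rewrite ReE !normCK fmorph_div /= !rmorphB /= -[X in (X - _) / _]aa.
by field; rewrite aw0 awc0.
Qed.

Lemma ex_crit_near (C : numClosedFieldType) (a r : C) (zs ws : seq C) :
  (\prod_(z <- [:: a, 0 & zs]) ('X - z%:P))^`()
    = (size ws).+1%:R *: \prod_(w <- ws) ('X - w%:P) ->
  size ws = (size zs).+1 ->
  `|a| = 1 -> {in zs, forall z, `|z| = 1} -> {in ws, forall w, `|w| = r} ->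
  0 < r < 1 -> (size ws)%:R <= 2 * (size ws).+1%:R * r ^+ 2 ->
  exists2 w, w \in ws & `|a - w| <= r.
Proof.
move=> dE sE a1 zs1 wsr /andP[r0 r1] ler2.
have aws : a \notin ws by apply/negP => /wsr; rewrite a1 => r1'; rewrite -r1' ltxx in r1.
(* A multiple zero [a] would be a critical point of modulus [1], not [r]. *)
have azs : a \notin 0 :: zs.
  apply: contra aws => azs; rewrite -root_prod_XsubC.
  have : root ((size ws).+1%:R *: \prod_(w <- ws) ('X - w%:P)) a.
    rewrite -dE big_cons derivM rootE !hornerE subrr mul0r addr0 derivXsubC.
    by rewrite !hornerE -[_ == 0]/(root _ a) root_prod_XsubC.
  by rewrite rootZ// pnatr_eq0.
have [/hasP[w ws_w wr]|/hasPn far] := boolP (has (fun w => `|a - w| <= r) ws).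
  by exists w.
(* The zero [0] contributes [1] and each [z] in [zs] contributes [1 / 2]; doubling gives
   [size zs + 2]. *)
have sumE : \sum_(w <- ws) 'Re (a / (a - w)) = (size ws).+1%:R.
  rewrite -raddf_sum -mulr_sumr (sum_inv_crit _ _ _ _ _ dE)//.
  rewrite mulrCA mulr_sumr mulr_natl raddfMn raddf_sum /= big_cons.
  have -> : \sum_(z <- zs) 'Re (a / (a - z)) = 2^-1 * (size zs)%:R.
    rewrite mulr_natr -iter_addr_0 -(count_predT zs) -big_const_seq.
    rewrite big_seq [RHS]big_seq.
    apply: eq_bigr => z zs_z.
    have az : a != z by apply: contra azs => /eqP->; rewrite inE zs_z orbT.
    by rewrite Re_div_sub// (zs1 _ zs_z) expr1n subrr mul0r addr0 mulr1.
  have a0 : a != 0 by rewrite -normr_eq0 a1 oner_eq0.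
  rewrite subr0 divff// (Creal_ReP 1 (real1 _)) sE -[_.+2]addn2 natrD.
  by field.
have : \sum_(w <- ws) 'Re (a / (a - w)) < \sum_(w <- ws) (2^-1 * r ^- 2).
  rewrite big_seq [ltRHS]big_seq; apply: ltr_sum.
    by case: ws sE {dE wsr ler2 aws far sumE} => [//|w ws] _ /=; rewrite mem_head.
  move=> w ws_w.
  have aw : a != w by apply: contra aws => /eqP->.
  have rlt : r < `|a - w|.
    by rewrite real_ltNge ?normr_real ?far// gtr0_real.
  rewrite Re_div_sub// (wsr _ ws_w) ltr_pM2l ?invr_gt0 ?ltr0n//.
  (* The bound is the value of the same expression at [|a - w| = r]. *)
  have -> : r ^- 2 = 1 + (1 - r ^+ 2) / r ^+ 2.
    by field; rewrite gt_eqF.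
  rewrite ltrD2l ltr_pM2l ?subr_gt0 ?expr_lt1 ?ltW//.
  rewrite ltf_pV2 ?posrE ?exprn_gt0//; last exact: lt_trans rlt.
  by rewrite ltr_pXn2r// nnegrE ?normr_ge0 ?ltW.
rewrite sumE big_const_seq count_predT iter_addr_0 -[ltRHS]mulr_natl -invfM.
rewrite ltr_pdivlMr ?mulr_gt0 ?exprn_gt0 ?ltr0n// mulrCA mulrA.
by move=> /lt_le_trans/(_ ler2); rewrite ltxx.
Qed.

Lemma ex_crit_dist_le (C : numClosedFieldType) (m : nat) (p : {poly C}) (r : C) :
  (0 < m)%N -> p \is monic -> size p = m.+2 ->
  (forall z, root p z -> `|z| <= 1) -> root p 0 ->
  0 <= r -> m.+1%:R * r ^+ m = 1 ->
  (forall w, root p^`() w -> r <= `|w|) ->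
  forall z, root p z -> exists2 w, root p^`() w & `|z - w| <= r.
Proof.
move=> m0 pm ps p1 p0 r_ge0 rE r_le z pz.
have r0 : 0 < r.
  rewrite lt_neqAle r_ge0 andbT; apply/eqP => r0.
  by move: rE; rewrite -r0 expr0n gtn_eqF// mulr0 => /eqP; rewrite eq_sym oner_eq0.
have r1 : r < 1.
  rewrite real_ltNge ?ger0_real//; apply/negP => /(exprn_ege1 m) r1.
  have : (1 : C) < 1; last by rewrite ltxx.
  rewrite -[ltRHS]rE; apply: (@lt_le_trans _ _ m.+1%:R); first by rewrite ltr1n.
  by rewrite ler_peMr.
have [ws ws_size dE] := deriv_monic_factorization _ _ _ pm ps.
have rootd w : root p^`() w = (w \in ws).
  by rewrite dE rootZ ?pnatr_eq0// root_prod_XsubC.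
have [zs pE] : {zs | p = \prod_(z <- 0 :: zs) ('X - z%:P)}.
  have [rs pE] := closed_field_poly_normal p.
  rewrite (monicP pm) scale1r in pE.
  move: p0; rewrite pE root_prod_XsubC => /perm_to_rem rsE.
  by exists (rem 0 rs); apply: perm_big.
have zs_size : size zs = m.
  by move: ps; rewrite pE size_prod_XsubC => -[].
have rootp x : root p x = (x \in 0 :: zs) by rewrite pE root_prod_XsubC.
(* Both sides are the modulus of the derivative at [0]. *)
have prodE : \prod_(x <- [seq `|z| | z <- zs]) x
    = m.+1%:R * \prod_(x <- [seq `|w| | w <- ws]) x.
  have : `|p^`()`_0| = `|p`_1| by rewrite coef_deriv mulr1n.
  rewrite dE pE big_cons coefZ subr0 coefXM !coef0_prod_XsubC.
  rewrite !normrM !normrX normrN1 !expr1n !mul1r !normr_prod normr_nat.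
  by rewrite !big_map.
have ws_ge : {in [seq `|w| | w <- ws], forall x, r <= x}.
  by move=> _ /mapP[w ww ->]; rewrite r_le// rootd.
have zs_le : {in [seq `|z| | z <- zs], forall x, 0 <= x <= 1}.
  by move=> _ /mapP[x xz ->]; rewrite normr_ge0 p1// rootp inE xz orbT.
(* The left side of [prodE] is at most [1 = (m + 1) * r ^ m], so the moduli of the critical points
   have product at most [r ^ m]. *)
have wsr : {in ws, forall w, `|w| = r}.
  move=> w ww; apply: (prod_le_exp_eq _ _ _ r0 ws_ge); last exact: map_f.
  rewrite size_map ws_size -(@ler_pM2l _ m.+1%:R)// rE -prodE.
  by rewrite big_seq prodr_ile1.
have zs1 : {in zs, forall z, `|z| = 1}.
  move=> x xz; apply: (prod_ge1_eq _ _ zs_le); last exact: map_f.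
  rewrite prodE -[leLHS]rE ler_pM2l// -ws_size -(size_map Num.norm).
  exact: prod_ge_exp.
(* For the zero [0] any critical point is at distance exactly [r], and one exists because
   [m > 0]. *)
move: pz; rewrite rootp inE => /predU1P[->|zz].
  case: ws ws_size wsr rootd {dE prodE ws_ge} => [|w ws]; first by move=> m0E; rewrite -m0E in m0.
  move=> _ wsr rootd; exists w; first by rewrite rootd mem_head.
  by rewrite sub0r normrN wsr// mem_head.
have [w ww zw] : exists2 w, w \in ws & `|z - w| <= r.
  have zsE := perm_to_rem zz.
  apply: (@ex_crit_near _ _ _ (rem z zs)).
  - rewrite ws_size -dE pE; congr _^`(); apply/esym/perm_big.
    rewrite (perm_trans _ (_ : perm_eq [:: 0, z & rem z zs] _)) ?perm_cons//.
    by rewrite -[0 :: _ :: _]/([:: 0] ++ [:: z] ++ _) perm_catCA.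
  - by rewrite ws_size -zs_size (perm_size zsE).
  - exact: zs1.
  - by move=> x /mem_rem; exact: zs1.
  - exact: wsr.
  - by rewrite r0.
  - by rewrite ws_size le_sqr_of_exp_eq.
by exists w; rewrite ?rootd.
Qed.

(** * The comparison polynomial and the conclusion *)

Lemma polyS0_XnsubX (R : realType) (n : nat) :
  (2 <= n)%N -> polyS0 n ('X^n - 'X : {poly R[i]}).
Proof.
case: n => [|[|m]]// _.
have sX : (size (- 'X : {poly R[i]}) < size ('X^(m.+2) : {poly R[i]}))%N.
  by rewrite size_polyN size_polyX size_polyXn.
split.
- by rewrite monicE lead_coefDl// lead_coefXn.
- by rewrite size_polyDl// size_polyXn.
- move=> z; rewrite rootE !hornerE exprS -[X in _ - X]mulr1 -mulrBr mulf_eq0.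
  move=> /orP[/eqP->|]; first by rewrite normc0.
  rewrite subr_eq0 => /eqP/(congr1 (fun x => `|x|)); rewrite normrX normr1.
  move=> /eqP; rewrite pexpr_eq1// => /eqP z1.
  by rewrite -lecR -[(normc z)%:C]/(`|z|) z1.
- by rewrite rootE !hornerE expr0n subrr.
Qed.

(** For degree at least 2 the derivative is not constant, so its zero set is finite and nonempty and
    the default value of [setmin] is never taken. *)
Lemma crit_setminP (R : realType) (n : nat) (p : {poly R[i]}) (f : R[i] -> R) :
  (2 <= n)%N -> polyS0 n p ->
  is_setmin [set f w | w in zeros p^`()] (setmin [set f w | w in zeros p^`()]).
Proof.
case: n => [|[|m]]// _ [pm ps _ _].
have [ws ws_size dE] := deriv_monic_factorization _ _ _ pm ps.
have ds : size p^`() = m.+2.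
  by rewrite dE size_scale ?pnatr_eq0// size_prod_XsubC ws_size.
apply: setminP.
  by apply/finite_image/finite_zeros; rewrite -size_poly_eq0 ds.
have [w dw] : nonempty (zeros p^`()) by apply: zeros_neq0; rewrite ds.
by exists (f w), w.
Qed.

Theorem corollary1 (R : realType) (n : nat) (p : {poly R[i]}) :
  (2 <= n)%N -> zero_maximal n p -> sendov_dist p = crit_radius p.
Proof.
move=> n2 [Sp pmax].
(* The modulus of [w0], a critical point of ['X^n - 'X], serves as [r]: the equation
   [n * w0 ^ (n - 1) = 1] gives the one required of [r]. *)
have [[w0 dw0 w0E] _] :=
  crit_setminP _ _ _ (@normc R) n2 (polyS0_XnsubX R n n2).
have [_ p_lb] := crit_setminP _ _ _ (@normc R) n2 Sp.
have w0_le : normc w0 <= crit_radius p.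
  by rewrite w0E; apply/pmax/polyS0_XnsubX.
have near z : root p z -> crit_dist p z <= normc w0.
  move=> pz; have [_ z_lb] := crit_setminP _ _ _ (fun w => normc (z - w)) n2 Sp.
  case: n n2 Sp dw0 {pmax w0E} => [|[|m]]// _ [pm ps p1 p0] dw0.
  have [w dw zw] : exists2 w, root p^`() w & `|z - w| <= `|w0|.
    apply: (@ex_crit_dist_le _ m.+1) => //.
    - by move=> x /p1; rewrite -lecR.
    - move: dw0; rewrite /zeros /= rootE derivB derivXn derivX.
      rewrite hornerD hornerN hornerMn hornerXn hornerC -mulr_natl.
      rewrite subr_eq0 => /eqP/(congr1 (fun x => `|x|)).
      by rewrite normrM normrX normr1 normr_nat.
    - move=> w dw; rewrite lecR; apply: (le_trans w0_le).
      by apply: p_lb; exists w.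
  rewrite lecR in zw; apply: le_trans zw.
  by apply: z_lb; exists w.
have p0 : root p 0 by case: Sp.
(* The value is attained at the zero [0], and [near] with [w0_le] bounds all others. A maximum thus
   exists, so [setmax] returns one instead of its default, and maxima are unique. *)
have max_p : is_setmax [set crit_dist p z | z in zeros p] (crit_radius p).
  split; last by move=> _ [z pz <-]; exact: le_trans (near _ pz) w0_le.
  exists 0 => //; rewrite /crit_dist /crit_radius; congr setmin.
  by apply: eq_imagel => w _; rewrite sub0r normcN.
have [sA sub] : is_setmax [set crit_dist p z | z in zeros p] (sendov_dist p).
  by apply: (xgetPex 0); exists (crit_radius p).
by apply/le_anti; rewrite (max_p.2 _ sA) sub//; case: max_p.
Qed.
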